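(* Let $U\le V_0\le V$ be finite-dimensional vector spaces over a field. There is a poset map $\phi:\mathcal{P}(V,V_0)\to\mathcal{P}(V/U,V_0/U)*\mathcal{P}(V,U)$ which is natural with respect to triples $(V\ge V_0\ge U)$ and induces a homotopy equivalence on geometric realizations.
   Context: For vector spaces $V_0\le V$, the relative building $\mathcal{P}(V,V_0)$ is the poset, ordered by inclusion, of proper subspaces $W<V$ with $W+V_0=V$. For posets $\mathcal{P},\mathcal{Q}$, the join $\mathcal{P}*\mathcal{Q}$ is the disjoint union with the orders of $\mathcal{P}$ and $\mathcal{Q}$ together with $a<b$ for all $a\in\mathcal{P}$, $b\in\mathcal{Q}$. *)

(* Defs.v *)
From HB Require Import structures.
From mathcomp Require Import all_boot all_order all_algebra.
From mathcomp Require Import all_classical all_reals topology.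
Set Implicit Arguments.
Unset Strict Implicit.
Unset Printing Implicit Defensive.
Import Order.TTheory GRing.Theory Num.Theory numFieldTopology.Exports.
Local Open Scope classical_set_scope.
Local Open Scope ring_scope.

(* Posets given by a carrier subset A of a choiceType T and an order le *)

Definition rel_building (K : fieldType) (V : vectType K) (V0 : {vspace V})
  : set {vspace V} :=
  [set W | W != fullv /\ (W + V0)%VS = fullv].

Definition subv_rel (K : fieldType) (V : vectType K) : rel {vspace V} :=
  fun W1 W2 => (W1 <= W2)%VS.

Definition join_set (T1 T2 : Type) (A1 : set T1) (A2 : set T2) : set (T1 + T2) :=
  fun x => match x with inl a => A1 a | inr b => A2 b end.

Definition join_le (T1 T2 : Type) (le1 : rel T1) (le2 : rel T2) : rel (T1 + T2) :=
  fun x y => match x, y with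
  | inl a, inl b => le1 a b
  | inr a, inr b => le2 a b
  | inl _, inr _ => true
  | inr _, inl _ => false
  end.

Definition poset_map (T1 T2 : Type) (A1 : set T1) (le1 : rel T1)
  (A2 : set T2) (le2 : rel T2) (f : T1 -> T2) : Prop :=
  (forall x, A1 x -> A2 (f x)) /\
  (forall x y, A1 x -> A1 y -> le1 x y -> le2 (f x) (f y)).

Section Realization.
Variables (R : realType) (T : choiceType) (A : set T) (le : rel T).

Definition supp (t : T -> R) : set T := [set x | t x != 0].

(* barycentric coordinates: finitely supported on a chain of A, >= 0, sum 1 *)
Definition is_point (t : T -> R) : Prop :=
  [/\ (forall x, 0 <= t x),
      finite_set (supp t),
      supp t `<=` A,
      (forall x y, supp t x -> supp t y -> le x y || le y x) &
      \sum_(x \in supp t) t x = 1].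

Definition realization : Type := {t : T -> R | is_point t}.

HB.instance Definition _ := gen_eqMixin realization.
HB.instance Definition _ := gen_choiceMixin realization.

(* Weak (coherent) topology: O is open iff its trace on every closed
   simplex (points supported in a finite chain S) is open for the
   Euclidean topology of that simplex. *)
Definition real_open (O : set realization) : Prop :=
  forall S : seq T, (forall x y, x \in S -> y \in S -> le x y || le y x) ->
  forall t : realization, O t -> (forall x, x \notin S -> sval t x = 0) ->
  exists2 e : R, 0 < e &
    forall s : realization, (forall x, x \notin S -> sval s x = 0) ->
      (forall x, x \in S -> `|sval s x - sval t x| < e) -> O s.

Lemma real_openT : real_open setT.
Proof. by move=> S _ t _ _; exists 1 => //. Qed.

Lemma real_openI : setI_closed real_open.
Proof.
move=> O1 O2 h1 h2 S hS t [t1 t2] ht.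
have [e1 e10 H1] := h1 S hS t t1 ht.
have [e2 e20 H2] := h2 S hS t t2 ht.
exists (Order.min e1 e2); first by rewrite lt_min e10 e20.
move=> s hs hd; split.
- apply: H1 => // x xS; have := hd x xS; rewrite lt_min => /andP[].
  by [].
- apply: H2 => // x xS; have := hd x xS; rewrite lt_min => /andP[].
  by [].
Qed.

Lemma real_open_bigU (I : Type) (f : I -> set realization) :
  (forall i, real_open (f i)) -> real_open (\bigcup_i f i).
Proof.
move=> hf S hS t [i _ ti] ht.
have [e e0 H] := hf i S hS t ti ht.
by exists e => // s hs hd; exists i => //; apply: H.
Qed.

HB.instance Definition _ :=
  isOpenTopological.Build realization real_openT real_openI real_open_bigU.

End Realization.

Definition pushforward (R : realType) (T1 T2 : choiceType) (f : T1 -> T2)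
  (t : T1 -> R) : T2 -> R :=
  fun b => \sum_(a \in [set a | f a = b]) t a.

Definition realizes (R : realType) (T1 T2 : choiceType)
  (A1 : set T1) (le1 : rel T1) (A2 : set T2) (le2 : rel T2)
  (f : T1 -> T2) (F : realization R A1 le1 -> realization R A2 le2) : Prop :=
  forall t, sval (F t) = pushforward f (sval t).

Definition homotopic (R : realType) (X Y : topologicalType) (f g : X -> Y) : Prop :=
  exists H : (X * R)%type -> Y,
    [/\ {within [set: X] `*` `[0%R, 1%R], continuous H},
        (forall x, H (x, 0%R) = f x) &
        (forall x, H (x, 1%R) = g x)].

Definition homotopy_equivalence (R : realType) (X Y : topologicalType)
  (f : X -> Y) : Prop :=
  continuous f /\
  exists g : Y -> X, [/\ continuous g,
    homotopic R (g \o f) idfun & homotopic R (f \o g) idfun].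

Definition induces_hequiv (R : realType) (T1 T2 : choiceType)
  (A1 : set T1) (le1 : rel T1) (A2 : set T2) (le2 : rel T2) (f : T1 -> T2) : Prop :=
  exists F : realization R A1 le1 -> realization R A2 le2,
    realizes f F /\ homotopy_equivalence R F.

(* Quotient data: pi : V -> Q is a surjective linear map with kernel U,
   i.e. Q "is" V/U, and pi @: V0 "is" V0/U. *)
Definition is_quotient (K : fieldType) (V Q : vectType K) (U : {vspace V})
  (pi : 'Hom(V, Q)) : Prop :=
  lker pi = U /\ limg pi = fullv.

Definition lin_iso (K : fieldType) (V V' : vectType K) (g : 'Hom(V, V')) : Prop :=
  lker g = 0%VS /\ limg g = fullv.

Definition map_sum (A1 A2 B1 B2 : Type) (f : A1 -> A2) (g : B1 -> B2)
  (x : A1 + B1) : A2 + B2 :=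
  match x with inl a => inl (f a) | inr b => inr (g b) end.

(* Main.v *)
(* The map sends W to (W + U)/U if W + U <> V, and to W otherwise.
   Call W a supplement if W + U = V.  Declaring every non-supplement to be
   below every supplement enlarges the order of X = P(V, V0) to an order X',
   and X' retracts onto the join P(V/U, V0/U) * P(V, U), since W <= W + U.
   It remains to invert |X| -> |X'|.  A simplex of X' is a chain of
   non-supplements c followed by a chain of supplements b; the vertex
   (c + U) :&: b lies in X below both c + U and b, and the modular law gives
   (c + U) :&: b + U = c + U.  So the inverse subdivides each edge (c, b) by a
   new vertex, pairs the mass on the c's with the mass on the b's in increasing
   order, and realizes (c, b) |-> (c + U) :&: b.  All homotopies are either
   straight lines inside a simplex or come from pairs of comparable poset maps;
   they are piecewise linear on simplices, hence continuous for the weak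
   topology. *)
Require Import Defs.
From HB Require Import structures.
From mathcomp Require Import all_boot all_order all_algebra.
From mathcomp Require Import all_classical all_reals topology normedtype.
From mathcomp Require Import lra.
Import Order.TTheory GRing.Theory Num.Theory.
Import numFieldTopology.Exports numFieldNormedType.Exports.
Set Implicit Arguments.
Unset Strict Implicit.
Unset Printing Implicit Defensive.
Local Open Scope classical_set_scope.
Local Open Scope ring_scope.

(** * Maxima and minima of reals: estimates and limits *)

Section MinMax.
Variable R : realType.
Implicit Types a b c l r : R.

(** The difference is the length of the part of [[a, b]] above [c]. *)
Lemma max_diff a b c : a <= b ->
  0 <= Num.max b c - Num.max a c /\ (Num.max b c - Num.max a c != 0 -> c < b).
Proof.
move=> ab; split; first by have [h1|h1] := leP b c; have [h2|h2] := leP a c; lra.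
by apply: contraNT; rewrite -leNgt => bc; rewrite !max_r ?subrr // (le_trans ab).
Qed.

(** The difference is the length of the part of [[a, b]] below [c]. *)
Lemma min_diff a b c : a <= b ->
  0 <= Num.min b c - Num.min a c /\ (Num.min b c - Num.min a c != 0 -> a < c).
Proof.
move=> ab; split; first by have [h1|h1] := leP b c; have [h2|h2] := leP a c; lra.
by apply: contraNT; rewrite -leNgt => ca; rewrite !min_r ?subrr // (le_trans ca).
Qed.

End MinMax.

Section RealFilters.
Variables (R : realType) (Z : Type) (F : set_system Z) (FF : Filter F).
Implicit Types (f g : Z -> R) (a b : R).

Lemma cvg_maxr f g a b : f @ F --> a -> g @ F --> b ->
  (fun z => Num.max (f z) (g z)) @ F --> Num.max a b.
Proof.
move=> fa gb; under eq_fun do rewrite maxr_absE.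
rewrite maxr_absE; apply: cvgM; last exact: cvg_cst.
by apply: cvgD; [exact: cvgD|apply: cvg_norm; exact: cvgB].
Qed.

Lemma cvg_minr f g a b : f @ F --> a -> g @ F --> b ->
  (fun z => Num.min (f z) (g z)) @ F --> Num.min a b.
Proof.
move=> fa gb; under eq_fun do rewrite minr_absE.
rewrite minr_absE; apply: cvgM; last exact: cvg_cst.
by apply: cvgB; [exact: cvgD|apply: cvg_norm; exact: cvgB].
Qed.

End RealFilters.

(** * Points of a realization and their finite supports *)

Section FiniteSums.
Variables (R : realType) (T : choiceType).
Implicit Types (t : T -> R) (S : seq T) (D : set T).

Lemma fsum_seq t S D : uniq S -> (forall x, x \notin S -> t x = 0) ->
  \sum_(x \in D) t x = \sum_(x <- S | x \in D) t x.
Proof.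
move=> uS tS; rewrite [RHS]bigfs //; last by move=> x _; exact: tS.
by rewrite set_mem_set.
Qed.

Lemma finite_supp_seq t : finite_set (supp t) ->
  exists2 S, uniq S & [set` S] = supp t.
Proof.
move=> /finite_seqP[S tS]; exists (undup S); first exact: undup_uniq.
by rewrite tS; apply/seteqP; split => x /=; rewrite mem_undup.
Qed.

Lemma sub_suppP t S : (forall x, x \notin S -> t x = 0) <->
  supp t `<=` [set` S].
Proof.
split=> [tS x|tS x]; rewrite /supp /=.
  by apply: contraNT => /tS ->.
by apply: contraNeq => /tS.
Qed.

End FiniteSums.

Section Points.
Variables (R : realType) (T : choiceType) (A : set T) (le : rel T).
Implicit Types (t : realization R A le) (S : seq T) (D : set T).

Definition on_chain S := forall x y, x \in S -> y \in S -> le x y || le y x.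

Lemma realization_inj t1 t2 : sval t1 = sval t2 -> t1 = t2.
Proof.
by case: t1 t2 => [t1 p1] [t2 p2] /= e; apply: eq_exist.
Qed.

Lemma point_ge0 t x : 0 <= sval t x.
Proof. by case: (svalP t) => h _ _ _ _; exact: h. Qed.

Lemma point_carrier t x : sval t x != 0 -> A x.
Proof. by case: (svalP t) => _ _ h _ _; exact: h. Qed.

Lemma point_chain t x y : sval t x != 0 -> sval t y != 0 -> le x y || le y x.
Proof. by case: (svalP t) => _ _ _ h _; exact: h. Qed.

Lemma point_seq t : exists S, [/\ uniq S, on_chain S,
  (forall x, x \in S = (sval t x != 0)) & (forall x, x \notin S -> sval t x = 0)].
Proof.
case: (svalP t) => _ /finite_supp_seq[S uS ES] _ ch _; exists S.
have SE x : x \in S = (sval t x != 0).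
  have /seteqP[S1 S2] := ES.
  by apply/idP/idP => [xS|xS]; [exact: S1|exact: S2].
split=> //; first by move=> x y; rewrite !SE; exact: ch.
by move=> x; rewrite SE negbK => /eqP.
Qed.

Lemma point_sum t S : uniq S -> (forall x, x \notin S -> sval t x = 0) ->
  \sum_(x <- S) sval t x = 1.
Proof.
move=> uS tS; case: (svalP t) => _ _ _ _ <-.
rewrite (fsbig_fwiden S) //; first exact/sub_suppP.
by move=> x [_]; rewrite /supp /= => /negP; rewrite negbK => /eqP.
Qed.

Lemma is_pointI (t : T -> R) S : uniq S -> (forall x, x \notin S -> t x = 0) ->
  (forall x, 0 <= t x) -> (forall x, t x != 0 -> A x) ->
  (forall x y, t x != 0 -> t y != 0 -> le x y || le y x) ->
  \sum_(x <- S) t x = 1 -> is_point A le t.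
Proof.
move=> uS tS t0 tA tch t1; split => //.
  by apply: (sub_finite_set ((sub_suppP t S).1 tS)); exact: finite_seq.
rewrite (fsbig_fwiden S) //; first exact/sub_suppP.
by move=> x [_]; rewrite /supp /= => /negP; rewrite negbK => /eqP.
Qed.

End Points.

(** * The weak topology: continuity tested simplex by simplex *)

Section SimplexFilter.
Variables (R : realType) (T : choiceType) (A : set T) (le : rel T).
Implicit Types (t : realization R A le) (S : seq T) (D : set T).

Definition on_simplex S t := forall x, x \notin S -> sval t x = 0.

(** Euclidean neighbourhoods of [t] within the closed simplex on [S]. Limits are taken along this
    filter because [real_open] inspects one simplex at a time. *)
Definition simplex_nbhs S t : set_system (realization R A le) :=
  [set N | exists2 e : R, 0 < e & forall s, on_simplex S s ->
     (forall x, x \in S -> `|sval s x - sval t x| < e) -> N s].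

#[global] Instance simplex_nbhs_filter S t : Filter (simplex_nbhs S t).
Proof.
split.
- by exists 1.
- move=> P Q [e1 e10 H1] [e2 e20 H2]; exists (Num.min e1 e2).
    by rewrite lt_min e10.
  by move=> s sS sd; split; [apply: H1|apply: H2] => // x xS;
    have := sd x xS; rewrite lt_min => /andP[].
- by move=> P Q PQ [e e0 H]; exists e => // s sS sd; apply: PQ; exact: H.
Qed.

Lemma simplex_nbhs_on S t : simplex_nbhs S t (on_simplex S).
Proof. by exists 1. Qed.

Lemma cvg_coord S t x : on_simplex S t ->
  (fun s => sval s x) @ simplex_nbhs S t --> sval t x.
Proof.
move=> tS; apply/cvgrPdist_lt => e e0; exists e => // s sS sd.
have [xS|xS] := boolP (x \in S); first by rewrite distrC; exact: sd.
by rewrite tS // sS // subrr normr0.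
Qed.

(** On a fixed simplex only the finitely many indices of [D] lying in [S] contribute, which leaves a
    finite sum of convergent coordinates. *)
Lemma cvg_mass S t D : on_simplex S t ->
  (fun s => \sum_(x \in D) sval s x) @ simplex_nbhs S t -->
    \sum_(x \in D) sval t x.
Proof.
move=> tS.
have E s : on_simplex S s ->
    \sum_(x \in D) sval s x = \sum_(x <- undup S | x \in D) sval s x.
  move=> sS; apply: fsum_seq; first exact: undup_uniq.
  by move=> x; rewrite mem_undup; exact: sS.
rewrite E //.
have : simplex_nbhs S t [set s | \sum_(x <- undup S | x \in D) sval s x =
    \sum_(x \in D) sval s x].
  by exists 1 => // s sS _ /=; rewrite E.
move=> /near_eq_cvg /cvg_trans; apply.
apply: cvg_big; first exact: add_continuous.
by move=> x _; exact: cvg_coord.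
Qed.

Lemma nbhs_simplex S t : on_chain le S -> on_simplex S t ->
  simplex_nbhs S t `=>` nbhs t.
Proof.
move=> cS tS N; rewrite nbhsE /= => -[O [oO Ot] ON].
by have [e e0 H] := oO S cS t Ot tS; exists e => // s sS sd; apply/ON/H.
Qed.

(* Tube lemma: the weak topology on |P| is coherent with its simplices, and
   stays so after a product with the locally compact line. *)
Lemma simplexwise_continuous (Z : topologicalType)
    (F : realization R A le * R -> Z) :
  (forall S t u, on_chain le S -> on_simplex S t ->
     F @ filter_prod (simplex_nbhs S t) (nbhs u) --> F (t, u)) ->
  continuous F.
Proof.
move=> cF [t0 u0] O; rewrite nbhsE => -[O' [oO' O't] O'O].
have [S0 [_ cS0 _ tS0]] := point_seq t0.
have [[N1 N2] /= [[e1 e10 N1e] /nbhs_ballP[e2 /= e20 N2e]] N12] :=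
  cF S0 t0 u0 cS0 tS0 O' (open_nbhs_nbhs (conj oO' O't)).
(* Half the radius makes [J] a compact interval inside the ball of radius [e2] that is still a
   neighbourhood of [u0]. *)
pose J := `[u0 - e2 / 2, u0 + e2 / 2]%classic.
pose N := [set t | J `<=` [set u | O' (F (t, u))]].
have Nt0 : N t0.
  move=> u; rewrite /J /= in_itv /= => /andP[u1 u2].
  apply: (N12 (t0, u)); split => /=.
    by apply: N1e => // x _; rewrite subrr normr0.
  by apply: N2e; rewrite /ball /= ltr_distl; apply/andP; split; lra.
(* On each simplex, compactness of [J] yields one radius around [t] that serves all [u] in [J]. *)
have oN : open N.
  move=> S cS t Nt tS.
  have := (compact_near_coveringP J).1 (@segment_compact R _ _).
  move=> /(_ _ (simplex_nbhs S t) (fun s u => O' (F (s, u))) _) [|e e0 H].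
    move=> u Ju.
    have [[M1 M2] /= [M1t M2u] M12] :=
      cF S t u cS tS O' (open_nbhs_nbhs (conj oO' (Nt u Ju))).
    by exists (M2, M1) => //= -[v s] /= [vM sM]; apply: (M12 (s, v)).
  by exists e.
exists (N, J) => /=; last first.
  by move=> [t u] /= [Nt Ju]; apply: O'O; exact: Nt.
split; first by apply: open_nbhs_nbhs; split.
apply/nbhs_ballP; exists (e2 / 2) => /=; first by rewrite divr_gt0.
move=> u; rewrite /ball /= ltr_distl /J /= in_itv /= => /andP[? ?].
by apply/andP; split; lra.
Qed.

(** [L] need not be a chain. Eventually the support of [f z] is a chain in [L] that contains the
    support of [t], so openness can be tested on that common face. *)
Lemma cvg_realization (Z : Type) (F : set_system Z) (FF : Filter F)
    (f : Z -> realization R A le) t (L : seq T) :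
  (\forall z \near F, on_simplex L (f z)) -> on_simplex L t ->
  (forall x, x \in L -> (fun z => sval (f z) x) @ F --> sval t x) ->
  f @ F --> t.
Proof.
move=> fL tL cf O; rewrite nbhsE => -[O' [oO' O't] O'O].
have nearL (P : T -> Z -> Prop) : (forall x, x \in L -> \forall z \near F, P x z) ->
    \forall z \near F, forall x, x \in L -> P x z.
  elim: L {fL tL cf} => [|x L IH] h; first exact: nearW.
  have h1 := h x (mem_head _ _).
  have h2 := IH (fun y yL => h y (mem_behead (s := x :: L) yL)).
  by apply: filterS2 h1 h2 => z zx zL y; rewrite inE => /predU1P[->|/zL].
(* [L] has finitely many sublists, so the conditions for all faces containing [t] hold
   simultaneously near the limit. *)
have near_face : \forall z \near F, forall m : (size L).-tuple bool,
    on_chain le (mask m L) -> on_simplex (mask m L) t ->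
    on_simplex (mask m L) (f z) -> O' (f z).
  apply: filter_forall => m.
  have [cm|ncm] := pselect (on_chain le (mask m L)); last exact: nearW.
  have [tm|ntm] := pselect (on_simplex (mask m L) t); last exact: nearW.
  have [e e0 He] := oO' _ cm t O't tm.
  have : \forall z \near F, forall x, x \in L -> `|sval (f z) x - sval t x| < e.
    apply: nearL => x xL; move/cvgrPdist_lt: (cf x xL) => /(_ _ e0).
    by apply: filterS => z; rewrite distrC.
  by apply: filterS => z zL _ _ fm; apply: He => // x /mem_mask; exact: zL.
have near_supp : \forall z \near F, forall x, x \in L ->
    sval t x != 0 -> sval (f z) x != 0.
  apply: nearL => x xL; have [_|tx0] := eqVneq (sval t x) 0; first exact: nearW.
  move/cvgrPdist_lt: (cf x xL) => /(_ `|sval t x|); rewrite normr_gt0 => /(_ tx0).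
  by apply: filterS => z + _; apply: contraTneq => ->; rewrite subr0 ltxx.
apply: filterS3 fL near_face near_supp => z zL Hf tz; apply: O'O.
(* The face chosen is the exact support of [f z]. *)
have szm : size [seq sval (f z) x != 0 | x <- L] == size L by rewrite size_map.
have fE x : (x \in mask (Tuple szm) L) = (x \in L) && (sval (f z) x != 0).
  by rewrite /= -filter_mask mem_filter andbC.
apply: (Hf (Tuple szm)).
- by move=> x y; rewrite !fE => /andP[_ xz] /andP[_ yz]; exact: point_chain xz yz.
- move=> x; rewrite fE; apply: contraNeq => tx.
  have xL : x \in L by apply: contraNT tx => /tL ->.
  by rewrite xL tz.
- move=> x; rewrite fE; have [xL|/zL//] := boolP (x \in L).
  by rewrite /= negbK => /eqP.
Qed.

End SimplexFilter.

(** [L S] is a finite set of vertices carrying the image of the whole simplex on [S]; with such a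
    bound, coordinatewise limits suffice. *)
Lemma continuous_realization_prod (R : realType) (T1 T2 : choiceType)
    (A1 : set T1) (le1 : rel T1) (A2 : set T2) (le2 : rel T2)
    (F : realization R A1 le1 * R -> realization R A2 le2)
    (L : seq T1 -> seq T2) :
  (forall S t u, on_simplex S t -> on_simplex (L S) (F (t, u))) ->
  (forall S t u y, on_chain le1 S -> on_simplex S t -> (fun z => sval (F z) y) @
     filter_prod (simplex_nbhs S t) (nbhs u) --> sval (F (t, u)) y) ->
  continuous F.
Proof.
move=> FL cF; apply: simplexwise_continuous => S t u cS tS.
apply: (@cvg_realization _ _ _ _ _ _ _ _ _ (L S)); last 2 first.
- exact: FL.
- by move=> y _; exact: cF.
exists (on_simplex S, setT); first by split; [exact: simplex_nbhs_on|exact: filterT].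
by move=> [s v] /= [sS _]; exact: FL.
Qed.

(** Places a space at height 0, so that continuity without a parameter follows from continuity on
    the product with the line. *)
Lemma slice0_continuous (R : realType) (X : topologicalType) :
  continuous (fun x : X => (x, 0 : R)).
Proof.
move=> x; apply: (@cvg_pair _ _ _ _ (nbhs x) (nbhs (0 : R)) _ _ _ id (cst 0)).
  exact: cvg_id.
exact: cvg_cst.
Qed.

Lemma continuous_realization (R : realType) (T1 T2 : choiceType)
    (A1 : set T1) (le1 : rel T1) (A2 : set T2) (le2 : rel T2)
    (F : realization R A1 le1 -> realization R A2 le2)
    (L : seq T1 -> seq T2) :
  (forall S t, on_simplex S t -> on_simplex (L S) (F t)) ->
  (forall S t y, on_simplex S t -> (fun s => sval (F s) y) @
     simplex_nbhs S t --> sval (F t) y) ->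
  continuous F.
Proof.
move=> FL cF.
have cF' : continuous (fun z : realization R A1 le1 * R => F z.1).
  apply: (@continuous_realization_prod _ _ _ _ _ _ _ _ L) => [S t u|S t u y _ tS] /=.
    exact: FL.
  by apply: (cvg_comp fst (fun s => sval (F s) y) _ (cF S t y tS)); exact: cvg_fst.
move=> t.
apply: (@continuous_comp _ _ _ (fun t => (t, 0 : R)) (fun z => F z.1) t).
  exact: slice0_continuous.
exact: cF'.
Qed.

Lemma bary_coord_continuous (R : realType) (T : choiceType) (A : set T) (le : rel T)
  (x : T) : continuous (fun t : realization R A le => sval t x).
Proof.
have c : continuous (fun z : realization R A le * R => sval z.1 x).
  apply: simplexwise_continuous => S t u cS tS.
  apply: (@cvg_comp _ _ _ fst (fun s : realization R A le => sval s x) _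
    (simplex_nbhs S t)); first exact: cvg_fst.
  exact: cvg_coord.
move=> t.
apply: (@continuous_comp _ _ R (fun t => (t, 0 : R))
  (fun z : realization R A le * R => sval z.1 x) t).
  exact: slice0_continuous.
exact: c.
Qed.

(** * Maps of realizations induced by poset maps *)

Lemma sum_seq_at (V : nmodType) (I : eqType) (r : seq I) (P : pred I) j (c : V) :
  uniq r -> j \in r -> \sum_(i <- r | P i && (j == i)) c = if P j then c else 0.
Proof.
move=> ur jr; rewrite big_mkcond (bigD1_seq j) //= eqxx andbT.
rewrite big1 ?addr0 // => i ij.
by rewrite [j == i]eq_sym (negbTE ij) andbF.
Qed.

Section Pushforward.
Variables (R : realType) (T1 T2 : choiceType).
Variables (A1 : set T1) (le1 : rel T1) (A2 : set T2) (le2 : rel T2).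
Implicit Types (f g : T1 -> T2) (t : realization R A1 le1).

Lemma pushforward_seq f (t : T1 -> R) (S : seq T1) y :
  uniq S -> (forall x, x \notin S -> t x = 0) ->
  pushforward f t y = \sum_(x <- S | f x == y) t x.
Proof.
move=> uS tS; rewrite /pushforward (fsum_seq _ uS tS).
by apply: eq_bigl => x; apply/idP/eqP; rewrite inE.
Qed.

Lemma pushforward_neq0 f t y : pushforward f (sval t) y != 0 ->
  exists2 x, sval t x != 0 & f x = y.
Proof.
have [S [uS _ SE tS]] := point_seq t; rewrite (pushforward_seq _ _ uS tS).
rewrite -big_filter => h.
have : has predT [seq x <- S | f x == y].
  by apply: contraNT h => /hasPn/(_ _ _)/negP n; rewrite big1_seq // => x /andP[_ /n].
by case/hasP => x; rewrite mem_filter SE => /andP[/eqP fx tx] _; exists x.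
Qed.

Lemma eq_pushforward f g t : (forall x, A1 x -> f x = g x) ->
  pushforward f (sval t) = pushforward g (sval t).
Proof.
move=> fg; apply/funext => y; have [S [uS _ SE tS]] := point_seq t.
rewrite !(pushforward_seq _ _ uS tS) big_seq_cond [RHS]big_seq_cond.
apply: eq_bigl => x; case: (boolP (x \in S)) => //=.
by rewrite SE => /point_carrier /fg ->.
Qed.

Lemma pushforward_on_simplex f t (S : seq T1) : on_simplex S t ->
  forall y, y \notin map f S -> pushforward f (sval t) y = 0.
Proof.
move=> tS y; apply: contraNeq => /pushforward_neq0[x tx <-].
by apply: map_f; apply: contraNT tx => /tS ->.
Qed.

Lemma pushforward_point f t : poset_map A1 le1 A2 le2 f ->
  is_point A2 le2 (pushforward f (sval t)).
Proof.
move=> [fA fle]; have [S [uS _ SE tS]] := point_seq t.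
apply: (@is_pointI _ _ _ _ _ (undup (map f S))).
- exact: undup_uniq.
- by move=> y; rewrite mem_undup; exact: pushforward_on_simplex.
- move=> y; rewrite (pushforward_seq _ _ uS tS).
  by apply: sumr_ge0 => x _; exact: point_ge0.
- by move=> y /pushforward_neq0[x /point_carrier /fA Ax <-].
- move=> _ _ /pushforward_neq0[x tx <-] /pushforward_neq0[y ty <-].
  have Ax := point_carrier tx; have Ay := point_carrier ty.
  by case/orP: (point_chain tx ty) => xy; rewrite (fle _ _ _ _ xy) ?orbT.
rewrite -(point_sum uS tS).
under eq_bigr do rewrite (pushforward_seq _ _ uS tS).
(* After the exchange each [x] contributes exactly once, at [f x]. *)
rewrite (exchange_big_dep predT) //=; apply: eq_big_seq => x xS.
by rewrite (sum_seq_at predT) ?mem_undup ?map_f ?undup_uniq.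
Qed.

Definition rmap f (pf : poset_map A1 le1 A2 le2 f) t : realization R A2 le2 :=
  exist _ _ (pushforward_point t pf).

Lemma rmap_continuous f (pf : poset_map A1 le1 A2 le2 f) : continuous (rmap pf).
Proof.
apply: (@continuous_realization _ _ _ _ _ _ _ _ (map f)).
  by move=> S t; exact: pushforward_on_simplex.
by move=> S t y tS; exact: cvg_mass.
Qed.

End Pushforward.

Lemma pushforward_comp (R : realType) (T1 T2 T3 : choiceType) (A1 : set T1)
    (le1 : rel T1) (f : T1 -> T2) (g : T2 -> T3) (t : realization R A1 le1) :
  pushforward g (pushforward f (sval t)) = pushforward (g \o f) (sval t).
Proof.
apply/funext => z; have [S [uS _ SE tS]] := point_seq t.
rewrite (pushforward_seq _ _ uS tS).
rewrite (@pushforward_seq _ _ _ _ _ (undup (map f S))) ?undup_uniq //; last first.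
  by move=> y; rewrite mem_undup; exact: pushforward_on_simplex.
under eq_bigr do rewrite (pushforward_seq _ _ uS tS).
rewrite (exchange_big_dep (fun x => g (f x) == z)) /=; last first.
  by move=> y x /eqP <- /eqP ->.
rewrite [LHS]big_seq_cond [RHS]big_seq_cond.
apply: eq_bigr => x /andP[xS gfx].
by rewrite (sum_seq_at (fun y => g y == z)) ?gfx ?mem_undup ?map_f ?undup_uniq.
Qed.

Lemma pushforward_id (R : realType) (T : choiceType) (t : T -> R) :
  pushforward idfun t = t.
Proof.
by apply/funext => x; rewrite /pushforward fsbig_set1.
Qed.

(* Homotopies parametrised by the whole real line compose without
   mentioning the subspace topology of [0, 1]. *)
Definition line_homotopic (R : realType) (X Y : topologicalType) (f g : X -> Y) :=
  exists H : X * R -> Y,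
    [/\ continuous H, (forall x, H (x, 0) = f x) & (forall x, H (x, 1) = g x)].

(** * Operations on homotopies and the straight-line homotopy *)

Section Homotopies.
Variable R : realType.
Implicit Types W X Y Z : topologicalType.

Lemma line_homotopic_homotopic X Y (f g : X -> Y) :
  line_homotopic R f g -> homotopic R f g.
Proof.
by move=> [H [cH H0 H1]]; exists H; split => //; exact: continuous_subspaceT.
Qed.

Lemma reparam_continuous X Y (H : X * R -> Y) (r : R -> R) :
  continuous H -> continuous r -> continuous (fun z : X * R => H (z.1, r z.2)).
Proof.
move=> cH cr z.
apply: (@continuous_comp _ _ _ (fun z : X * R => (z.1, r z.2)) H); last exact: cH.
apply: (@cvg_pair _ _ _ _ (nbhs z.1) (nbhs (r z.2)) _ _ _ fst (r \o snd)).
  exact: cvg_fst.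
by apply: continuous_comp; [exact: cvg_snd|exact: cr].
Qed.

Lemma line_homotopic_sym X Y (f g : X -> Y) :
  line_homotopic R f g -> line_homotopic R g f.
Proof.
move=> [H [cH H0 H1]]; exists (fun z => H (z.1, 1 - z.2)); split.
- apply: (@reparam_continuous _ _ _ (fun u : R => 1 - u)) => // u.
  by apply: cvgB; [exact: cvg_cst|exact: cvg_id].
- by move=> x /=; rewrite subr0.
- by move=> x /=; rewrite subrr.
Qed.

Lemma line_homotopic_trans X Y (f g h : X -> Y) :
  line_homotopic R f g -> line_homotopic R g h -> line_homotopic R f h.
Proof.
move=> [H [cH H0 H1]] [K [cK K0 K1]].
exists (fun z => if z.2 <= 1 / 2 then H (z.1, 2 * z.2) else K (z.1, 2 * z.2 - 1)).
split; last 2 first.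
- by move=> x /=; rewrite ifT ?mulr0 //; lra.
- by move=> x /=; rewrite ifF; [rewrite mulr1 (_ : 2 - 1 = 1) //; lra|lra].
pose H' (z : X * R) := H (z.1, 2 * z.2).
pose K' (z : X * R) := K (z.1, 2 * z.2 - 1).
pose C := [set z : X * R | z.2 <= 1 / 2].
pose D := [set z : X * R | 1 / 2 <= z.2].
have cH2 : continuous H'.
  apply: (@reparam_continuous _ _ _ (fun u : R => 2 * u)) => // u.
  by apply: cvgM; [exact: cvg_cst|exact: cvg_id].
have cK2 : continuous K'.
  apply: (@reparam_continuous _ _ _ (fun u : R => 2 * u - 1)) => // u.
  apply: cvgB; last exact: cvg_cst.
  by apply: cvgM; [exact: cvg_cst|exact: cvg_id].
have csnd : continuous (@snd X R) by move=> z; exact: cvg_snd.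
(* Pasting lemma for the two closed half-cylinders. *)
have CD : C `|` D = setT.
  apply/seteqP; split => // z _; rewrite /C /D /=.
  by have [|/ltW] := leP z.2 (1 / 2); [left|right].
apply/continuous_subspace_setT; rewrite -CD.
apply: withinU_continuous.
- exact: (@closed_comp _ _ snd [set u : R | u <= 1 / 2] (in1W csnd) (@closed_le R _)).
- exact: (@closed_comp _ _ snd [set u : R | 1 / 2 <= u] (in1W csnd) (@closed_ge R _)).
- apply: (@subspace_eq_continuous _ C _ (from_subspace C H')).
    by move=> z; rewrite inE /from_subspace => zC; rewrite /H' ifT.
  exact: continuous_subspaceT.
- apply: (@subspace_eq_continuous _ D _ (from_subspace D K')).
    case=> x u; rewrite inE /from_subspace /D /K' /= => u1; case: ifPn => // u2.
    (* On the overlap of the halves both formulas give [g x]. *)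
    have -> : u = 1 / 2 by lra.
    have -> : 2 * (1 / 2) = 1 :> R by lra.
    by rewrite subrr H1 K0.
  exact: continuous_subspaceT.
Qed.

Lemma line_homotopic_comp W X Y Z (f g : X -> Y) (k : Y -> Z) (l : W -> X) :
  continuous k -> continuous l ->
  line_homotopic R f g -> line_homotopic R (k \o f \o l) (k \o g \o l).
Proof.
move=> ck cl [H [cH H0 H1]]; exists (fun z => k (H (l z.1, z.2))); split.
- move=> z; apply: (@continuous_comp _ _ _ (fun z : W * R => H (l z.1, z.2)) k);
    last exact: ck.
  apply: (@continuous_comp _ _ _ (fun z : W * R => (l z.1, z.2)) H); last exact: cH.
  apply: (@cvg_pair _ _ _ _ (nbhs (l z.1)) (nbhs z.2) _ _ _ (l \o fst) snd).
    by apply: continuous_comp; [exact: cvg_fst|exact: cl].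
  exact: cvg_snd.
- by move=> x /=; rewrite H0.
- by move=> x /=; rewrite H1.
Qed.

End Homotopies.

(** [F t] lies in the closed simplex spanned by the support of [t], so the segment from [F t] to [t]
    stays in it. *)
Lemma straight_line_homotopic (R : realType) (T : choiceType) (A : set T)
    (le : rel T) (F : realization R A le -> realization R A le) :
  continuous F -> (forall t x, sval t x = 0 -> sval (F t) x = 0) ->
  line_homotopic R F idfun.
Proof.
move=> cF F0.
(* Time runs over the whole line; clamping it to [[0, 1]] keeps the combination convex. *)
pose c (u : R) := Num.min 1 (Num.max 0 u).
have c01 u : 0 <= c u <= 1.
  by rewrite /c; have [] := leP 0 u; have [] := leP 1 u; have [] := leP 1 (0 : R); lra.
pose h t u x := (1 - c u) * sval (F t) x + c u * sval t x.
have h0 t u x : sval t x = 0 -> h t u x = 0.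
  by move=> tx; rewrite /h tx F0 // !mulr0 addr0.
have hP t u : is_point A le (h t u).
  have [S [uS _ SE tS]] := point_seq t.
  have FS x : x \notin S -> sval (F t) x = 0 by move=> /tS /F0.
  apply: (@is_pointI _ _ _ _ _ S); first exact: uS.
  - by move=> x /tS /h0.
  - move=> x; have /andP[? ?] := c01 u.
    by apply: addr_ge0; apply: mulr_ge0; rewrite ?point_ge0 ?subr_ge0.
  - by move=> x hx; apply: (@point_carrier _ _ _ _ t); apply: contraNneq hx => /h0 ->.
  - by move=> x y hx hy; apply: (@point_chain _ _ _ _ t); [move: hx|move: hy];
      apply: contraNneq => /h0 ->.
  - by rewrite big_split /= -!mulr_sumr !point_sum //; lra.
exists (fun z => exist _ _ (hP z.1 z.2)); split.
- apply: (@continuous_realization_prod _ _ _ _ _ _ _ _ id).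
    by move=> S t u tS x xS; apply: h0; exact: tS.
  move=> S t u y cS tS.
  pose G := filter_prod (simplex_nbhs S t) (nbhs u).
  have ct : (fun z : realization R A le * R => sval z.1 y) @ G --> sval t y.
    apply: (@cvg_comp _ _ _ fst (fun s : realization R A le => sval s y) _
      (simplex_nbhs S t)); first exact: cvg_fst.
    exact: cvg_coord.
  have cFS : (fun z : realization R A le * R => sval (F z.1) y) @ G --> sval (F t) y.
    apply: (@cvg_comp _ _ _ fst (fun s : realization R A le => sval (F s) y) _
      (simplex_nbhs S t)); first exact: cvg_fst.
    have cy : continuous (fun s : realization R A le => sval (F s) y).
      move=> s; apply: (@continuous_comp _ _ R F (fun s : realization R A le => sval s y)).
        exact: cF.
      exact: (@bary_coord_continuous R T A le y).
    apply: cvg_trans (cy t); apply: cvg_app; exact: nbhs_simplex.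
  have cu : (fun z : realization R A le * R => c z.2) @ G --> c u.
    apply: cvg_minr; first exact: cvg_cst.
    by apply: cvg_maxr; [exact: cvg_cst|exact: cvg_snd].
  apply: cvgD; apply: cvgM => //.
  by apply: cvgB => //; exact: cvg_cst.
- by move=> t; apply: realization_inj; apply/funext => x /=;
    rewrite /h /c maxxx min_r // subr0 mul0r addr0 mul1r.
- by move=> t; apply: realization_inj; apply/funext => x /=;
    rewrite /h /c max_r // minxx subrr mul0r add0r mul1r.
Qed.

(** * Arranging the mass of a point as consecutive intervals *)

Definition porder_rel (T : eqType) (le : rel T) :=
  [/\ reflexive le, antisymmetric le & transitive le].

Section Telescope.
Variables (R : realType) (T : choiceType) (le : rel T).
Hypothesis (le_ord : porder_rel le).

(** Along the chain the intervals are adjacent and start at [c], so the increments of [h] telescope.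
    A general [c] lets the induction shift past the head. *)
Lemma telescope_chain (t : T -> R) (h : R -> R) (c : R) (s : seq T) :
  uniq s -> pairwise le s ->
  \sum_(x <- s) (h (c + \sum_(y <- s | le y x && (y != x)) t y + t x) -
                 h (c + \sum_(y <- s | le y x && (y != x)) t y)) =
  h (c + \sum_(y <- s) t y) - h c.
Proof.
case: le_ord => lexx le_anti _.
elim: s c => [|x s IH] c /=; first by rewrite !big_nil addr0 subrr.
move=> /andP[xs us] /andP[/allP lexs ps].
rewrite big_cons [in X in _ = X]big_cons addrA.
have -> : \sum_(y <- x :: s | le y x && (y != x)) t y = 0.
  rewrite big_cons eqxx andbF big1_seq // => y /andP[/andP[yx nyx] ys].
  by move: nyx; rewrite (le_anti y x) ?eqxx // yx lexs.
rewrite addr0.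
have -> : h (c + t x + \sum_(y <- s) t y) - h c =
  h (c + t x) - h c + (h (c + t x + \sum_(y <- s) t y) - h (c + t x)) by lra.
rewrite -(IH (c + t x)) //; congr (_ + _); apply: eq_big_seq => z zs.
rewrite big_cons lexs // (_ : x != z) /= ?addrA //.
by apply: contraNneq xs => ->.
Qed.

End Telescope.

Section Masses.
Variables (R : realType) (T : choiceType) (A : set T) (le : rel T).
Variable k : T -> bool.
Hypothesis (le_ord : porder_rel le).
Implicit Types t : realization R A le.

(* Listing the vertices of the support of [t] of a given class [k] in
   increasing order, [x] occupies the interval [lowmass t x, upmass t x[
   of length [t x]. *)
Definition lowmass (t : T -> R) x :=
  \sum_(y \in [set y | [&& le y x, y != x & k y == k x]]) t y.
Definition upmass (t : T -> R) x := lowmass t x + t x.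
Definition mass (t : T -> R) i := \sum_(y \in [set y | k y == i]) t y.

Lemma fsum_pred t (S : seq T) (P : pred T) :
  uniq S -> on_simplex S t ->
  \sum_(x \in [set x | P x]) sval t x = \sum_(x <- S | P x) sval t x.
Proof.
move=> uS tS; rewrite (fsum_seq _ uS tS); apply: eq_bigl => x.
by apply/idP/idP; rewrite inE.
Qed.

Lemma lowmass_ge0 t x : 0 <= lowmass (sval t) x.
Proof. by apply: fsumr_ge0 => y _; exact: point_ge0. Qed.

Lemma low_le_up t x : lowmass (sval t) x <= upmass (sval t) x.
Proof. by rewrite lerDl point_ge0. Qed.

Lemma mass_ge0 t i : 0 <= mass (sval t) i.
Proof. by apply: fsumr_ge0 => y _; exact: point_ge0. Qed.

Lemma mass_split t : mass (sval t) false + mass (sval t) true = 1.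
Proof.
have [S [uS _ SE tS]] := point_seq t.
rewrite /mass !(@fsum_pred t S) // -[RHS](point_sum uS tS).
rewrite [RHS](bigID k) /= addrC; congr (_ + _); apply: eq_bigl => x;
  by case: (k x).
Qed.

Lemma upmassE t x (S : seq T) : uniq S -> on_simplex S t ->
  upmass (sval t) x = \sum_(y <- S | le y x && (k y == k x)) sval t y.
Proof.
case: le_ord => lexx _ _ uS tS; rewrite /upmass /lowmass (@fsum_pred t S) //.
have [xS|/[dup] xS /tS ->] := boolP (x \in S); last first.
  rewrite addr0 big_seq_cond [RHS]big_seq_cond; apply: eq_bigl => y.
  by have [->|] := eqVneq y x; rewrite ?(negbTE xS).
rewrite [RHS]big_mkcond (bigD1_seq x) //= lexx eqxx addrC; congr (_ + _).
rewrite -big_mkcondr; apply: eq_bigl => y.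
by case: (le y x); case: (y != x).
Qed.

(** Every [z] of the class with [z] below [x] is strictly below [y], by transitivity and
    antisymmetry, hence is counted on the right as well. *)
Lemma up_le_low t x y : le x y -> x != y -> k x = k y ->
  upmass (sval t) x <= lowmass (sval t) y.
Proof.
case: le_ord => lexx le_anti le_trans xy nxy kxy.
have [S [uS _ SE tS]] := point_seq t.
rewrite (@upmassE t x S) // /lowmass (@fsum_pred t S) //.
rewrite [leRHS](bigID (fun z => le z x)) /= [leLHS](_ : _ =
  \sum_(z <- S | [&& le z y, z != y & k z == k y] && le z x) sval t z).
  by rewrite lerDl; apply: sumr_ge0 => z _; exact: point_ge0.
apply: eq_bigl => z; rewrite kxy; have [zx|] := boolP (le z x); last first.
  by rewrite andbF.
rewrite (le_trans _ _ _ zx xy) andbT (_ : z != y) //.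
by apply: contraNneq nxy => zy; rewrite -zy in xy *; rewrite (le_anti x z) // xy.
Qed.

Lemma up_le_mass t x : upmass (sval t) x <= mass (sval t) (k x).
Proof.
have [S [uS _ SE tS]] := point_seq t.
rewrite (@upmassE t x S) // /mass (@fsum_pred t S) //.
rewrite [leRHS](bigID (fun z => le z x)) /=.
under eq_bigl do rewrite andbC.
by rewrite lerDl; apply: sumr_ge0 => z _; exact: point_ge0.
Qed.

(** Turns positions of intervals back into the order: otherwise [y] is strictly below [x] in the
    chain and its interval ends before that of [x] starts. *)
Lemma low_lt_up_le t x y : sval t x != 0 -> sval t y != 0 -> k x = k y ->
  lowmass (sval t) x < upmass (sval t) y -> le x y.
Proof.
case: le_ord => lexx _ _ tx ty kxy; have [<-|nxy] := eqVneq x y; first by [].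
case/orP: (point_chain tx ty) => // yx; rewrite ltNge.
by rewrite up_le_low // eq_sym.
Qed.

(** Once sorted, the intervals of class [i] tile [[0, mass t i]]. Taking a clamp for [h] later sums
    overlaps with a fixed interval. *)
Lemma telescope_mass t (S : seq T) i (h : R -> R) : uniq S -> on_simplex S t ->
  on_chain le S ->
  \sum_(x <- S | k x == i) (h (upmass (sval t) x) - h (lowmass (sval t) x)) =
  h (mass (sval t) i) - h 0.
Proof.
case: (le_ord) => lexx le_anti le_trans uS tS cS.
pose s := sort le [seq x <- S | k x == i].
have sE x : (x \in s) = (k x == i) && (x \in S) by rewrite mem_sort mem_filter.
have us : uniq s by rewrite sort_uniq filter_uniq.
have bigs (F : T -> R) : \sum_(x <- S | k x == i) F x = \sum_(x <- s) F x.
  by rewrite -big_filter; apply: perm_big; rewrite perm_sym perm_sort.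
have ps : pairwise le s.
  rewrite -sorted_pairwise //; apply: (@sort_sorted_in _ (mem S)).
    by move=> x y; exact: cS.
  by apply/allP => x; rewrite mem_filter => /andP[].
rewrite /mass (@fsum_pred t S) // !bigs.
have := @telescope_chain R T le le_ord (sval t) h 0 s us ps; rewrite add0r => <-.
apply: eq_big_seq => x; rewrite sE => /andP[/eqP kx xS].
rewrite /upmass.
suff -> : lowmass (sval t) x = \sum_(y <- s | le y x && (y != x)) sval t y.
  by rewrite add0r.
rewrite /lowmass (@fsum_pred t S) // kx.
rewrite (eq_bigl (fun y => (k y == i) && (le y x && (y != x)))); last first.
  by move=> y; case: (le y x); case: (y != x); case: (k y == i).
by rewrite -big_filter_cond; apply: perm_big; rewrite perm_sym perm_sort.
Qed.

Lemma cvg_lowmass S t x : on_simplex S t ->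
  (fun s : realization R A le => lowmass (sval s) x) @ simplex_nbhs S t -->
    lowmass (sval t) x.
Proof. exact: cvg_mass. Qed.

Lemma cvg_upmass S t x : on_simplex S t ->
  (fun s : realization R A le => upmass (sval s) x) @ simplex_nbhs S t -->
    upmass (sval t) x.
Proof. by move=> tS; apply: cvgD; [exact: cvg_mass|exact: cvg_coord]. Qed.

End Masses.

(** * Comparable poset maps have homotopic realizations *)

Section ComparableMaps.
Variables (R : realType) (T : choiceType) (A : set T) (le : rel T).
Hypothesis (le_ord : porder_rel le).
Implicit Types t : realization R A le.

(** A single class: all vertices share one row of intervals, filling [[0, 1]]. *)
Let k : T -> bool := xpredT.

(* Triangulation of |P| x [0, 1] by |P x {0 < 1}|: at time u the part of the
   mass lying above 1 - u has moved to the upper copy. *)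
Definition prism_weight (t : T -> R) (u : R) (p : T * bool) : R :=
  let op := if p.2 then Num.max else Num.min in
  op (upmass le k t p.1) (1 - u) - op (lowmass le k t p.1) (1 - u).

Definition prism_set : set (T * bool) := [set p | A p.1].
Definition prism_le : rel (T * bool) := fun p q => le p.1 q.1 && (p.2 ==> q.2).

Lemma prism_weight0 (t : T -> R) u p : t p.1 = 0 -> prism_weight t u p = 0.
Proof.
by move=> tx; rewrite /prism_weight /upmass tx addr0; case: ifP; rewrite subrr.
Qed.

Lemma prism_weightD (t : T -> R) u x :
  prism_weight t u (x, false) + prism_weight t u (x, true) = t x.
Proof.
rewrite /prism_weight /=.
have := addr_max_min (upmass le k t x) (1 - u).
have := addr_max_min (lowmass le k t x) (1 - u).
by rewrite /upmass; lra.
Qed.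

Lemma prism_point t u : is_point prism_set prism_le (prism_weight (sval t) u).
Proof.
have [S [uS _ SE tS]] := point_seq t.
have lu x := low_le_up k t x.
have w0 p : prism_weight (sval t) u p != 0 -> sval t p.1 != 0.
  by apply: contraNneq => /prism_weight0 ->.
apply: (@is_pointI _ _ _ _ _ ([seq (x, false) | x <- S] ++ [seq (x, true) | x <- S])).
- rewrite cat_uniq !map_inj_uniq ?uS ?andbT /=; try by move=> x y [].
  by apply/hasPn => _ /mapP[x _ ->]; apply/mapP => -[].
- case=> x i; rewrite mem_cat negb_or => /andP[xf xt].
  apply: prism_weight0; apply: tS => /=.
  by case: i xf xt => [_|+ _]; apply: contraNN; exact: map_f.
- case=> x i; rewrite /prism_weight /=.
  by case: i => /=; [case: (max_diff (1 - u) (lu x))|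
    case: (min_diff (1 - u) (lu x))].
- by move=> p /w0 /point_carrier.
- case=> [x i] [y j] /[dup] /w0 /= tx wx /[dup] /w0 /= ty wy.
  (* A lower copy carries mass below [1 - u] and an upper copy mass above it, so [x'] starts before
     [1 - u] and [y'] ends after it. *)
  have lt x' y' : sval t x' != 0 -> sval t y' != 0 ->
      prism_weight (sval t) u (x', false) != 0 ->
      prism_weight (sval t) u (y', true) != 0 -> le x' y'.
    move=> tx' ty' wx' wy'; apply: (low_lt_up_le (k := k) le_ord tx' ty') => //.
    case: (min_diff (1 - u) (lu x')) => _ /(_ wx').
    by case: (max_diff (1 - u) (lu y')) => _ /(_ wy'); lra.
  rewrite /prism_le /=; case: i j wx wy => [] [] wx wy /=; rewrite ?andbT ?andbF /=.
  + exact: point_chain tx ty.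
  + exact: lt.
  + by rewrite lt.
  + exact: point_chain tx ty.
- rewrite big_cat !big_map /= -big_split /= -[RHS](point_sum uS tS).
  by apply: eq_bigr => x _; exact: prism_weightD.
Qed.

Lemma pushforward_pair (t : T -> R) (i : bool) x j :
  pushforward (fun x : T => (x, i)) t (x, j) = if i == j then t x else 0.
Proof.
rewrite /pushforward; case: eqP => [<-|ij].
  rewrite (_ : [set _ | _] = [set x]) ?fsbig_set1 //.
  by apply/seteqP; split => y /= => [[]|->].
rewrite (_ : [set _ | _] = set0) ?fsbig_set0 //.
by apply/seteqP; split => y //= [].
Qed.

Lemma prism_weight_start t :
  prism_weight (sval t) 0 = pushforward (fun x => (x, false)) (sval t).
Proof.
apply/funext => -[x i]; rewrite pushforward_pair /prism_weight /= subr0.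
have lu := low_le_up k t x; have := up_le_mass k le_ord t x.
(* The two class masses sum to 1 and the one of class [false] is nonnegative, so every interval ends
   at or before the cut, which is 1. *)
have := mass_split k t; have := mass_ge0 k t false; rewrite -[k x]/true => m0 m1 um.
by case: i => /=; [rewrite !max_r|rewrite !min_l]; rewrite /upmass in lu um *; lra.
Qed.

Lemma prism_weight_end t :
  prism_weight (sval t) 1 = pushforward (fun x => (x, true)) (sval t).
Proof.
apply/funext => -[x i]; rewrite pushforward_pair /prism_weight /= subrr.
have lu := low_le_up k t x; have := lowmass_ge0 k t x => l0.
by case: i => /=; [rewrite !max_l|rewrite !min_r]; rewrite /upmass in lu *; lra.
Qed.

Definition prism (z : realization R A le * R) : realization R prism_set prism_le :=
  exist _ _ (prism_point z.1 z.2).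

Lemma prism_continuous : continuous prism.
Proof.
apply: (@continuous_realization_prod _ _ _ _ _ _ _ _
  (fun S => [seq (x, false) | x <- S] ++ [seq (x, true) | x <- S])).
  move=> S t u tS [x i]; rewrite mem_cat negb_or => /andP[xf xt].
  apply: prism_weight0; apply: tS => /=.
  by case: i xf xt => [_|+ _]; apply: contraNN; exact: map_f.
move=> S t u [x i] cS tS.
pose G := filter_prod (simplex_nbhs S t) (nbhs u).
have cl : (fun z : realization R A le * R => lowmass le k (sval z.1) x) @ G -->
    lowmass le k (sval t) x.
  apply: (@cvg_comp _ _ _ fst (fun s : realization R A le => lowmass le k (sval s) x) _
    (simplex_nbhs S t)); first exact: cvg_fst.
  exact: cvg_lowmass.
have cu : (fun z : realization R A le * R => upmass le k (sval z.1) x) @ G -->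
    upmass le k (sval t) x.
  apply: (@cvg_comp _ _ _ fst (fun s : realization R A le => upmass le k (sval s) x) _
    (simplex_nbhs S t)); first exact: cvg_fst.
  exact: cvg_upmass.
have c1 : (fun z : realization R A le * R => 1 - z.2) @ G --> 1 - u.
  by apply: cvgB; [exact: cvg_cst|exact: cvg_snd].
rewrite /prism /prism_weight /=.
by case: i; apply: cvgB; (apply: cvg_maxr || apply: cvg_minr).
Qed.

(** [f] on the lower copy and [g] on the upper copy form a single poset map on the prism, because
    [f x] is below [g x]. *)
Lemma comparable_homotopic (T' : choiceType) (A' : set T') (le' : rel T')
    (f g : T -> T') (pf : poset_map A le A' le' f) (pg : poset_map A le A' le' g) :
  transitive le' -> (forall x, A x -> le' (f x) (g x)) ->
  line_homotopic R (rmap (R := R) pf) (rmap (R := R) pg).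
Proof.
move=> le'_trans fg.
pose fg' (p : T * bool) := if p.2 then g p.1 else f p.1.
have pfg : poset_map prism_set prism_le A' le' fg'.
  split; first by move=> [x []] Ax; [apply: pg.1|apply: pf.1].
  move=> [x i] [y j] /= Ax Ay /andP[/= xy]; rewrite /fg' /=.
  case: i Ax => Ax; case: j Ay => Ay //= _; [exact: pg.2|apply: le'_trans (fg _ Ay)|];
    exact: pf.2.
exists (rmap pfg \o prism); split.
- move=> z; apply: continuous_comp; first exact: prism_continuous.
  exact: rmap_continuous.
- move=> t; apply: realization_inj => /=; rewrite prism_weight_start pushforward_comp.
  exact: eq_pushforward.
- move=> t; apply: realization_inj => /=; rewrite prism_weight_end pushforward_comp.
  exact: eq_pushforward.
Qed.

End ComparableMaps.

(** * Overlaps of intervals and the subdivision of mixed edges *)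

Section Overlap.
Variable R : realType.
Implicit Types a b l r c : R.

Definition clamp a b c := Num.min b (Num.max a c).

(* Length of the intersection of [a, b] and [l, r]. *)
Definition overlap a b l r := clamp a b r - clamp a b l.

(** The clamp form telescopes when [[l, r]] runs through adjacent intervals; this form shows the
    symmetry between the two intervals. *)
Lemma overlapE a b l r : a <= b -> l <= r ->
  overlap a b l r = Num.max 0 (Num.min b r - Num.max a l).
Proof.
move=> ab lr; rewrite /overlap /clamp.
case: (leP a r) => ?; case: (leP a l) => ?; rewrite !minEle;
  do ![case: ifPn; rewrite -?ltNge => ?]; rewrite maxEle;
  by case: ifPn; rewrite -?ltNge => ?; lra.
Qed.

Lemma overlap_ge0 a b l r : a <= b -> l <= r -> 0 <= overlap a b l r.
Proof. by move=> ab lr; rewrite overlapE // le_max lexx. Qed.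

Lemma overlapC a b l r : a <= b -> l <= r -> overlap a b l r = overlap l r a b.
Proof. by move=> ab lr; rewrite !overlapE // minC [Num.max a l]maxC. Qed.

Lemma overlap_neq0 a b l r : a <= b -> l <= r -> overlap a b l r != 0 ->
  a < r /\ l < b.
Proof.
move=> ab lr; rewrite overlapE // => ov.
have : 0 < Num.min b r - Num.max a l.
  by rewrite ltNge; apply: contraNN ov => h; rewrite max_l.
by rewrite subr_gt0 lt_min !gt_max => /andP[/andP[_ ->] /andP[->]].
Qed.

(** Cuts [[a, b]] at [c]: the paired part below and the excess above. *)
Lemma clamp_rest a b c : a <= b ->
  clamp a b c - a + (Num.max b c - Num.max a c) = b - a.
Proof.
move=> ab; rewrite /clamp; case: (leP a c) => ?; case: (leP b c) => ?;
  by rewrite ?minEle; do ?[case: ifPn; rewrite -?ltNge => ?]; lra.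
Qed.

Lemma clamp0 a b : 0 <= a -> a <= b -> clamp a b 0 = a.
Proof. by move=> a0 ab; rewrite /clamp max_l // min_r. Qed.

Lemma cvg_clamp (Z : Type) (F : set_system Z) (FF : Filter F)
    (f g h : Z -> R) a b c :
  f @ F --> a -> g @ F --> b -> h @ F --> c ->
  (fun z => clamp (f z) (g z) (h z)) @ F --> clamp a b c.
Proof. by move=> fa gb hc; apply: cvg_minr => //; exact: cvg_maxr. Qed.

End Overlap.

Section JoinSubdivision.
Variables (R : realType) (T : choiceType) (A : set T) (le : rel T).
Variable k : T -> bool.
Hypothesis (le_ord : porder_rel le).
Hypothesis k_up : forall x y, le x y -> k x -> k y.
Implicit Types t : realization R A le.

Local Notation low := (lowmass le k).
Local Notation up := (upmass le k).
Local Notation mass := (mass k).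

(* Each edge from a vertex [c] outside [k] to a vertex [b] in [k] is subdivided
   by a new vertex [inr (c, b)] lying below both ends. *)
Definition sub_set : set (T + T * T) := fun z => match z with
  | inl x => A x
  | inr p => [/\ A p.1, A p.2, ~~ k p.1, k p.2 & le p.1 p.2]
  end.

(** An edge vertex meets an old vertex through its end of the same class. Old vertices of different
    classes are incomparable. *)
Definition sub_le : rel (T + T * T) := fun z w => match z, w with
  | inl x, inl y => le x y && (k x == k y)
  | inr p, inr q => le p.1 q.1 && le p.2 q.2
  | inr p, inl x => if k x then le p.2 x else le p.1 x
  | inl _, inr _ => false
  end.

(* The masses outside and inside [k] are paired off in increasing order; each
   pairing contributes its mass twice, and the excess of the larger side stays
   where it is. *)
Definition sub_weight (t : T -> R) (z : T + T * T) : R := match z with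
  | inl x => Num.max (up t x) (mass t (~~ k x)) - Num.max (low t x) (mass t (~~ k x))
  | inr p => if ~~ k p.1 && k p.2 then
      2 * overlap (low t p.1) (up t p.1) (low t p.2) (up t p.2) else 0
  end.

Definition sub_seq (S : seq T) : seq (T + T * T) :=
  map inl S ++ [seq inr (c, b) | c <- S, b <- S].

Lemma sub_order : porder_rel sub_le.
Proof.
case: le_ord => lexx le_anti le_trans; split.
- by case=> [x|[c b]] /=; rewrite !lexx ?eqxx.
- case=> [x|[c b]] [y|[c' b']] //=; rewrite ?andbF //.
    by move=> /andP[/andP[xy _] /andP[yx _]]; rewrite (le_anti x y) ?xy.
  move=> /andP[/andP[c1 b1] /andP[c2 b2]].
  by rewrite (le_anti c c') ?c1 // (le_anti b b') ?b1.
- case=> [y|[c' b']] [x|[c b]] [z|[c'' b'']] //=.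
  + move=> /andP[xy /eqP ->] /andP[yz ->].
    by rewrite (le_trans _ _ _ xy yz).
  + move=> + /andP[yz /eqP <-]; case: ifP => _ h; exact: le_trans h yz.
  + by move=> /andP[cc bb]; case: ifP => _ h; [exact: le_trans bb h|exact: le_trans cc h].
  + move=> /andP[cc bb] /andP[cc' bb'].
    by rewrite (le_trans _ _ _ cc cc') (le_trans _ _ _ bb bb').
Qed.

Lemma sub_weight_inl t x : sub_weight (sval t) (inl x) != 0 ->
  sval t x != 0 /\ mass (sval t) (~~ k x) < up (sval t) x.
Proof.
move=> w; split; first by apply: contraNneq w => tx; rewrite /= /upmass tx addr0 subrr.
by case: (max_diff (mass (sval t) (~~ k x)) (low_le_up k t x)) => _; apply.
Qed.

Lemma sub_weight_inr t c b : sub_weight (sval t) (inr (c, b)) != 0 ->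
  [/\ ~~ k c, k b, sval t c != 0 & sval t b != 0] /\
  (low (sval t) c < up (sval t) b /\ low (sval t) b < up (sval t) c).
Proof.
rewrite /=; case: ifPn => [/andP[kc kb]|]; last by rewrite eqxx.
rewrite mulf_eq0 negb_or => /andP[_ w].
have lc := low_le_up k t c; have lb := low_le_up k t b.
split; last exact: overlap_neq0 w.
split=> //; move: w; apply: contraNneq => tx.
  rewrite overlapC // /overlap /upmass tx addr0 subrr //.
by rewrite /overlap /upmass tx addr0 subrr.
Qed.

Lemma sub_weight_on_simplex t S : on_simplex S t ->
  forall z, z \notin sub_seq S -> sub_weight (sval t) z = 0.
Proof.
move=> tS [x|[c b]]; rewrite mem_cat negb_or => /andP[z1 z2]; apply/eqP.
  apply: contraNT z1 => /sub_weight_inl[tx _]; apply: map_f.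
  by apply: contraNT tx => /tS ->.
apply: contraNT z2 => /sub_weight_inr[[_ _ tc tb] _].
apply: (allpairs_f (fun c b => inr (c, b))).
  by apply: contraNT tc => /tS ->.
by apply: contraNT tb => /tS ->.
Qed.

(** The overlaps of one interval with the whole opposite row add up to its part below the opposite
    mass; the excess is the rest, so each old vertex accounts for its own mass. *)
Lemma sub_weight_sum t S : uniq S -> on_simplex S t -> on_chain le S ->
  \sum_(z <- sub_seq S) sub_weight (sval t) z = 1.
Proof.
move=> uS tS cS; set w := sub_weight _.
have lu x := low_le_up k t x; have l0 x := lowmass_ge0 k t x.
pose o c b := overlap (low (sval t) c) (up (sval t) c) (low (sval t) b) (up (sval t) b).
pose q x := clamp (low (sval t) x) (up (sval t) x) (mass (sval t) (~~ k x))
  - low (sval t) x.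
have row c : ~~ k c -> \sum_(b <- S | k b) o c b = q c.
  move=> kc; rewrite /q kc -{2}(clamp0 (l0 c) (lu c)).
  rewrite -(telescope_mass k le_ord _ (clamp (low (sval t) c) (up (sval t) c)) uS tS cS).
  by apply: eq_bigl => b; rewrite eqb_id.
have col b : k b -> \sum_(c <- S | ~~ k c) o c b = q b.
  move=> kb; rewrite /q kb -{2}(clamp0 (l0 b) (lu b)).
  rewrite -(telescope_mass k le_ord _ (clamp (low (sval t) b) (up (sval t) b)) uS tS cS).
  apply: eq_big => [c|c _]; first by case: (k c).
  by rewrite /o overlapC.
have pairs : \sum_(z <- [seq inr (c, b) | c <- S, b <- S]) w z = \sum_(x <- S) q x.
  rewrite big_allpairs_dep /= (bigID k) /= [X in X + _]big1 ?add0r; last first.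
    by move=> c kc; rewrite big1 // => b _; rewrite /w /= kc.
  transitivity (\sum_(c <- S | ~~ k c) 2 * \sum_(b <- S | k b) o c b).
    apply: eq_bigr => c kc; rewrite mulr_sumr [RHS]big_mkcond.
    by apply: eq_bigr => b _; rewrite /w /= kc.
  (* The factor 2 is split: one copy of each overlap is charged to [c], the other to [b]. *)
  rewrite -mulr_sumr mulr2n mulrDl mul1r.
  rewrite [RHS](bigID k) /= addrC; congr (_ + _);
    first by apply: eq_bigr => c; exact: row.
  by rewrite exchange_big /=; apply: eq_bigr => b; exact: col.
rewrite big_cat big_map /= pairs -big_split /= -[RHS](point_sum uS tS).
apply: eq_bigr => x _; rewrite addrC /q /w /=.
by rewrite clamp_rest // /upmass addrC addKr.
Qed.

Lemma sub_point t : is_point sub_set sub_le (sub_weight (sval t)).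
Proof.
have [S [uS cS SE tS]] := point_seq t.
case: (le_ord) => lexx _ _.
have lt x y := @low_lt_up_le R T A le k le_ord t x y.
apply: (@is_pointI _ _ _ _ _ (sub_seq S)).
- rewrite cat_uniq map_inj_uniq ?uS; last by move=> x y [].
  rewrite allpairs_uniq //; last by move=> [? ?] [? ?] _ _ [-> ->].
  rewrite andbT /=; apply/hasPn => _ /allpairsP[[c b] [_ _ ->]].
  by apply/mapP => -[].
- exact: sub_weight_on_simplex.
- case=> [x|[c b]] /=.
    by case: (max_diff (mass (sval t) (~~ k x)) (low_le_up k t x)).
  by case: ifP => // _; rewrite mulr_ge0 // overlap_ge0 // low_le_up.
- case=> [x|[c b]] => [/sub_weight_inl[/point_carrier]//|].
  move=> /sub_weight_inr[[kc kb tc tb] _]; split => //=;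
    [exact: point_carrier tc|exact: point_carrier tb|].
  by case/orP: (point_chain tc tb) => // /k_up /(_ kb) kc'; rewrite kc' in kc.
(* An excess vertex reaches beyond the mass of the opposite row, hence beyond every overlap, so it
   lies above the end of its class. *)
- have inlr x c b : sub_weight (sval t) (inl x) != 0 ->
      sub_weight (sval t) (inr (c, b)) != 0 -> sub_le (inr (c, b)) (inl x).
    move=> /sub_weight_inl[tx mx] /sub_weight_inr[[kc kb tc tb] [cb bc]] /=.
    have mc := up_le_mass k le_ord t c; have mb := up_le_mass k le_ord t b.
    rewrite (negbTE kc) in mc; rewrite kb in mb.
    case: ifPn mx => [kx /= mx|kx /= mx].
      by apply: lt; rewrite ?kb ?kx //; lra.
    by apply: lt; rewrite ?(negbTE kc) ?(negbTE kx) //; lra.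
  case=> [x|[c b]] [y|[c' b']] wz ww.
  + move: wz ww => /sub_weight_inl[tx mx] /sub_weight_inl[ty my] /=.
    have := up_le_mass k le_ord t x; have := up_le_mass k le_ord t y.
    have [<-|kxy] := eqVneq (k x) (k y).
      by rewrite !andbT => _ _; exact: point_chain tx ty.
    (* Excess on both sides would make each class mass larger than the other. *)
    by case: (k x) (k y) kxy mx my => [] [] //= _ *; lra.
  + by rewrite (inlr _ _ _ wz ww) orbT.
  + by rewrite (inlr _ _ _ ww wz).
  + move: wz ww => /sub_weight_inr[[kc kb tc tb] [cb bc]].
    move=> /sub_weight_inr[[kc' kb' tc' tb'] [cb' bc']] /=.
    have kcc : k c = k c' by rewrite (negbTE kc) (negbTE kc').
    have kbb : k b = k b' by rewrite kb kb'.
    (* Staircase argument: if [c] precedes [c'], then [b] starts before [c] ends, hence before [c']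
       starts, hence before [b'] ends. *)
    have [<-|ncc] := eqVneq c c'; first by rewrite !lexx /=; exact: point_chain tb tb'.
    case/orP: (point_chain tc tc') => le_c.
      have := up_le_low le_ord t le_c ncc kcc => h.
      by rewrite le_c lt //; lra.
    rewrite eq_sym in ncc; have := up_le_low le_ord t le_c ncc (esym kcc) => h.
    by rewrite le_c [le b' b]lt ?orbT //; lra.
- exact: sub_weight_sum.
Qed.

Definition subdivide t : realization R sub_set sub_le := exist _ _ (sub_point t).

Lemma subdivide_continuous : continuous subdivide.
Proof.
apply: (@continuous_realization _ _ _ _ _ _ _ _ sub_seq).
  by move=> S t; exact: sub_weight_on_simplex.
move=> S t z tS.
have cl x := @cvg_lowmass _ _ _ _ k S t x tS.
have cu x := @cvg_upmass _ _ _ _ k S t x tS.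
have cm i : (fun s : realization R A le => mass (sval s) i) @ simplex_nbhs S t
    --> mass (sval t) i by exact: cvg_mass.
case: z => [x|[c b]] /=; first by apply: cvgB; exact: cvg_maxr.
case: ifP => _; last exact: cvg_cst.
by apply: cvgM; [exact: cvg_cst|apply: cvgB; exact: cvg_clamp].
Qed.

Definition sub_fst (z : T + T * T) := match z with inl x => x | inr p => p.1 end.

Lemma sub_fst_poset_map : poset_map sub_set sub_le A le sub_fst.
Proof.
case: le_ord => _ _ le_trans; split; first by case=> [x|[c b]] //= [].
case=> [x|[c b]] [y|[c' b']] //=.
- by move=> _ _ /andP[].
- move=> [_ _ _ _ cb] _; case: ifP => // _; exact: le_trans.
- by move=> _ _ /andP[].
Qed.

(** Projecting edge vertices to their lower ends only moves mass within the support of [t], so a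
    straight line joins the composite to the identity. *)
Lemma subdivide_homotopic :
  line_homotopic R (rmap sub_fst_poset_map \o subdivide) idfun.
Proof.
apply: straight_line_homotopic.
  move=> t; apply: continuous_comp; first exact: subdivide_continuous.
  exact: rmap_continuous.
move=> t x tx; apply/eqP/negPn/negP => /pushforward_neq0[[y|[c b]]].
  by move=> /sub_weight_inl[+ _] /= yx; rewrite yx tx eqxx.
by move=> /sub_weight_inr[[_ _ + _] _] /= cx; rewrite cx tx eqxx.
Qed.

End JoinSubdivision.

(** * A criterion for equivalence through an enlarged order *)

Section SplitEquivalence.
Variables (R : realType) (T T2 : choiceType) (A : set T) (le : rel T).
Variables (A2 : set T2) (le2 : rel T2) (k : T -> bool).
Hypothesis le_ord : porder_rel le.
Hypothesis k_up : forall x y, le x y -> k x -> k y.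

(* The order of the join of the parts of [T] outside and inside [k]. *)
Definition split_le : rel T := fun x y => le x y || (~~ k x && k y).

Lemma split_order : porder_rel split_le.
Proof.
case: le_ord => lexx le_anti le_trans; split.
- by move=> x; rewrite /split_le lexx.
- move=> x y; rewrite /split_le.
  have := @k_up x y; have := @k_up y x.
  case: (boolP (le x y)) => xy; case: (boolP (le y x)) => yx //= h1 h2.
  + by move=> _; apply: le_anti; rewrite xy yx.
  + by move=> /andP[ky kx]; move: (h2 isT kx); rewrite (negbTE ky).
  + by rewrite andbT => /andP[kx ky]; move: (h1 isT ky); rewrite (negbTE kx).
  + by move=> /andP[/andP[/negbTE -> _] /andP[]].
- move=> y x z; rewrite /split_le => /orP[xy|/andP[kx ky]] /orP[yz|/andP[ky' kz]].
  + by rewrite (le_trans _ _ _ xy yz).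
  + by rewrite kz (contraNN (k_up xy) ky') orbT.
  + by rewrite kx (k_up yz ky) orbT.
  + by rewrite kx kz orbT.
Qed.

Lemma split_le_up x y : split_le x y -> k x -> k y.
Proof. by move=> /orP[/k_up//|/andP[/negbTE ->]]. Qed.

Lemma split_le_same x y : k x = k y -> split_le x y = le x y.
Proof. by rewrite /split_le => ->; case: (k y); rewrite ?andbF orbF. Qed.

(** Weights depend on the order only within one class, where both orders agree. *)
Lemma split_sub_weight (t : T -> R) : sub_weight split_le k t = sub_weight le k t.
Proof.
have low x : lowmass split_le k t x = lowmass le k t x.
  rewrite /lowmass; apply: eq_fsbigl; apply/seteqP; split => y /=.
    by move=> /and3P[yx -> /eqP e]; rewrite -(split_le_same e) yx e eqxx.
  by move=> /and3P[yx -> /eqP e]; rewrite (split_le_same e) yx e eqxx.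
by apply/funext => -[x|[c b]]; rewrite /= /upmass !low.
Qed.

(** [phi] retracts the enlarged order onto the target with section [s]. [m] turns the vertices of
    the subdivision back into elements of the original poset. *)
Variables (phi : T -> T2) (s : T2 -> T) (m : T + T * T -> T).
Hypothesis phi_split : poset_map A split_le A2 le2 phi.
Hypothesis s_split : poset_map A2 le2 A split_le s.
Hypothesis phiK : forall y, A2 y -> phi (s y) = y.
Hypothesis le_s_phi : forall x, A x -> split_le x (s (phi x)).
Hypothesis m_map : poset_map (sub_set A split_le k) (sub_le le k) A le m.
Hypothesis phi_m : forall z, sub_set A split_le k z -> phi (m z) = phi (sub_fst z).
Hypothesis le_fst_m : forall z, sub_set A le k z -> le (sub_fst z) (m z).

Let split_trans : transitive split_le. Proof. by case: split_order. Qed.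

Let phi_map : poset_map A le A2 le2 phi.
Proof.
split; first exact: phi_split.1.
by move=> x y Ax Ay xy; apply: phi_split.2 => //; rewrite /split_le xy.
Qed.

Let s_phi_map : poset_map A le A split_le (s \o phi).
Proof.
split=> [x Ax|x y Ax Ay xy] /=; first by apply/s_split.1/phi_map.1.
by apply: s_split.2; [exact: phi_map.1|exact: phi_map.1|exact: phi_map.2].
Qed.

Let id_map : poset_map A le A split_le idfun.
Proof. by split=> // x y _ _ xy; rewrite /split_le xy. Qed.

Let sub_set_le z : sub_set A le k z -> sub_set A split_le k z.
Proof.
by case: z => [x|[c b]] //= [Ac Ab kc kb cb]; split; rewrite // /split_le cb.
Qed.

(** [sub_le] only compares ends of equal class, so both orders induce the same relation on these
    vertices. *)
Let m_split_map : poset_map (sub_set A split_le k) (sub_le split_le k) A le m.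
Proof.
split; first exact: m_map.1.
move=> z w Az Aw zw; apply: m_map.2 => //; move: z w Az Aw zw.
case=> [x|[c b]] [y|[c' b']] //=.
- by move=> _ _ /andP[+ /eqP e]; rewrite split_le_same // e eqxx => ->.
- move=> [_ _ kc kb _] _; case: ifPn => ky; rewrite split_le_same //.
    by rewrite kb ky.
  by rewrite (negbTE kc) (negbTE ky).
- move=> [_ _ kc kb _] [_ _ kc' kb' _]; rewrite !split_le_same //.
    by rewrite kb kb'.
  by rewrite (negbTE kc) (negbTE kc').
Qed.

Let m_le_map : poset_map (sub_set A le k) (sub_le le k) A le m.
Proof.
split=> [z /sub_set_le /m_map.1//|z w /sub_set_le Az /sub_set_le Aw].
exact: m_map.2.
Qed.

Let subdivide_split := @subdivide R T A split_le k split_order split_le_up.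
Let subdivide_le := @subdivide R T A le k le_ord k_up.

Definition split_inverse : realization R A2 le2 -> realization R A le :=
  rmap m_split_map \o subdivide_split \o rmap s_split.

Lemma split_inverse_continuous : continuous split_inverse.
Proof.
move=> t; apply: continuous_comp; first exact: rmap_continuous.
apply: continuous_comp; first exact: subdivide_continuous.
exact: rmap_continuous.
Qed.

Lemma split_induces_hequiv : induces_hequiv R A le A2 le2 phi.
Proof.
exists (rmap phi_map); split; first by [].
split; first exact: rmap_continuous.
exists split_inverse; split; first exact: split_inverse_continuous.
- apply: line_homotopic_homotopic.
  (* In the enlarged order [s (phi x)] lies above [x], so [s \o phi] can be replaced by the
     identity. *)
  have -> : split_inverse \o rmap phi_map =
      (rmap m_split_map \o subdivide_split) \o rmap s_phi_map \o idfun.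
    apply/funext => t; apply: realization_inj => /=.
    by rewrite pushforward_comp.
  apply: (@line_homotopic_trans _ _ _ _
    ((rmap m_split_map \o subdivide_split) \o rmap id_map \o idfun)).
    apply: line_homotopic_comp.
    + move=> t; apply: continuous_comp; first exact: subdivide_continuous.
      exact: rmap_continuous.
    + by move=> t; exact: cvg_id.
    + by apply: line_homotopic_sym; exact: comparable_homotopic.
  apply: (@line_homotopic_trans _ _ _ _ (idfun \o rmap m_le_map \o subdivide_le)).
    (* On points of the original realization both subdivisions have the same weights. *)
    have -> : (rmap m_split_map \o subdivide_split) \o rmap id_map \o idfun =
        idfun \o rmap m_le_map \o subdivide_le.
      apply/funext => t; apply: realization_inj => /=.
      by rewrite pushforward_id split_sub_weight.
    exists (fun z => rmap m_le_map (subdivide_le z.1)); split => // z.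
    apply: (@continuous_comp _ _ _ fst (rmap m_le_map \o subdivide_le)).
      exact: cvg_fst.
    apply: continuous_comp; first exact: subdivide_continuous.
    exact: rmap_continuous.
  apply: line_homotopic_trans (subdivide_homotopic R A le_ord k_up).
  apply: (@line_homotopic_comp R _ _ _ _ _ _ idfun subdivide_le).
  + by move=> t; exact: cvg_id.
  + exact: subdivide_continuous.
  (* On genuine edges [m] lies above [sub_fst], which reduces the claim to the straight-line
     homotopy. *)
  + apply: line_homotopic_sym; apply: comparable_homotopic => //.
      exact: sub_order.
    by case: le_ord.
- apply: line_homotopic_homotopic.
  pose f := sub_fst_poset_map A k split_order.
  (* After [phi], [m] and [sub_fst] agree, so the subdivision homotopy of the enlarged order can be
     conjugated by [phi] and [s]. *)
  have -> : rmap phi_map \o split_inverse =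
      rmap phi_split \o (rmap f \o subdivide_split) \o rmap s_split.
    apply/funext => t; apply: realization_inj.
    pose d := subdivide_split (rmap s_split t).
    transitivity (pushforward (phi \o m) (sval d)); first exact: pushforward_comp.
    transitivity (pushforward (phi \o sub_fst (T := T)) (sval d)).
      exact: eq_pushforward.
    exact/esym/pushforward_comp.
  have -> : idfun = rmap phi_split \o idfun \o rmap s_split :> (realization R A2 le2 -> _).
    apply/funext => t; apply: realization_inj => /=.
    rewrite pushforward_comp -[LHS]pushforward_id.
    by apply: eq_pushforward => y /phiK.
  apply: line_homotopic_comp; [exact: rmap_continuous|exact: rmap_continuous|].
  exact: subdivide_homotopic.
Qed.

End SplitEquivalence.

(** * Relative buildings, quotients and supplements *)

Section RelativeBuilding.
Variables (K : fieldType) (V Q : vectType K) (U V0 : {vspace V}) (pi : 'Hom(V, Q)).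

Definition supplements (W : {vspace V}) := (W + U == fullv)%VS.

Definition building_map (W : {vspace V}) : {vspace Q} + {vspace V} :=
  if supplements W then inr W else inl (pi @: W)%VS.

Definition building_section (y : {vspace Q} + {vspace V}) : {vspace V} :=
  match y with inl X => (pi @^-1: X)%VS | inr W => W end.

(** A non-supplement [W] goes to [W + U] for monotonicity: the meet attached to an edge below it
    lies in [W + U] but possibly not in [W]. *)
Definition building_meet (z : {vspace V} + {vspace V} * {vspace V}) :=
  match z with
  | inl W => if supplements W then W else (W + U)%VS
  | inr p => ((p.1 + U) :&: p.2)%VS
  end.

Hypothesis sUV0 : (U <= V0)%VS.
Hypothesis quo : is_quotient U pi.

Lemma subv_order : porder_rel (@subv_rel K V).
Proof.
split; [exact: subvv|by move=> W1 W2; rewrite -eqEsubv => /eqP|].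
by move=> W1 W2 W3; exact: subv_trans.
Qed.

Lemma supplements_up W1 W2 : subv_rel W1 W2 -> supplements W1 -> supplements W2.
Proof.
move=> s12 /eqP s1; rewrite /supplements eqEsubv subvf /= -s1.
by rewrite addvS.
Qed.

Lemma quotient_imgDU W : (pi @: (W + U) = pi @: W)%VS.
Proof.
by case: quo => <- _; rewrite limgD (eqP (_ : pi @: lker pi == 0)%VS) ?addv0 // -lkerE.
Qed.

Lemma quotient_preim_img W : (pi @^-1: (pi @: W) = W + U)%VS.
Proof.
apply/eqP; rewrite eqEsubv subv_add; apply/and3P; split; apply/subvP => v.
- rewrite -memv_preim => /memv_imgP[w Ww piv].
  rewrite -[v](subrK w) addrC; apply: memv_add => //.
  by case: quo => <- _; rewrite memv_ker linearB /= piv subrr.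
- by move=> Wv; rewrite -memv_preim memv_img.
- by case: quo => <- _; rewrite memv_ker -memv_preim => /eqP ->; exact: mem0v.
Qed.

Lemma quotient_img_preim X : (pi @: (pi @^-1: X) = X)%VS.
Proof. by apply: lpreimK; case: quo => _ ->; exact: subvf. Qed.

Lemma quotient_preimDU X : (pi @^-1: X + U = pi @^-1: X)%VS.
Proof. by rewrite -quotient_preim_img quotient_img_preim. Qed.

Lemma quotient_preim_full X : (pi @^-1: X == fullv)%VS = (X == fullv).
Proof.
case: quo => _ piV; apply/eqP/eqP => [e|->].
  by rewrite -(quotient_img_preim X) e piV.
by rewrite -piV quotient_preim_img; apply/eqP; rewrite eqEsubv subvf addvSl.
Qed.

Lemma supplements_preim X : supplements (pi @^-1: X)%VS = (X == fullv).
Proof. by rewrite /supplements quotient_preimDU quotient_preim_full. Qed.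

Lemma supplements_img W : (pi @: W == fullv)%VS = supplements W.
Proof. by rewrite /supplements -quotient_preim_img quotient_preim_full. Qed.

Local Notation A := (rel_building V0).
Local Notation A2 := (join_set (rel_building (pi @: V0)%VS) (rel_building U)).
Local Notation le := (@subv_rel K V).
Local Notation le2 := (join_le (@subv_rel K Q) (@subv_rel K V)).

Lemma building_map_split :
  poset_map A (split_le le supplements) A2 le2 building_map.
Proof.
rewrite /building_map; split=> [W [nW WV0]|W1 W2 _ _].
  case: ifPn => [/eqP sW|sW] //=; split; first by rewrite supplements_img.
  by case: quo => _ piV; rewrite -limgD WV0.
case: ifPn => s1; case: ifPn => s2 //=;
  rewrite /split_le ?s1 ?s2 ?(negbTE s1) ?(negbTE s2) ?orbF //=.
  by move=> /supplements_up /(_ s1); rewrite (negbTE s2).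
exact: limgS.
Qed.

Lemma building_section_split :
  poset_map A2 le2 A (split_le le supplements) building_section.
Proof.
split=> [[X|W]|[X1|W1] [X2|W2]] //=.
- move=> [nX XV0]; split; first by rewrite quotient_preim_full.
  (* Since [U] lies in [V0], the sum is the full preimage of its image, which is [X + pi V0]. *)
  have -> : (pi @^-1: X + V0 = pi @^-1: X + V0 + U)%VS.
    by rewrite -addvA (addv_idPl sUV0).
  rewrite -quotient_preim_img limgD quotient_img_preim XV0; apply/eqP.
  by rewrite quotient_preim_full.
- move=> [nW WU]; split=> //; apply/eqP; rewrite eqEsubv subvf /= -WU.
  by rewrite addvS.
- by move=> _ _ X12; rewrite /split_le [le _ _]lpreimS.
(* The preimage of a proper subspace is never a supplement, so the cross relation of the join is one
   of the added relations. *)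
- move=> [nX _] [_ WU] _; rewrite /split_le supplements_preim nX.
  by rewrite /supplements WU eqxx orbT.
- by move=> _ _ W12; rewrite /split_le W12.
Qed.

Lemma meet_supplementDU W B : supplements B -> (((W + U) :&: B) + U = W + U)%VS.
Proof.
move=> /eqP BU; rewrite vspace_modr ?addvSr // BU; apply/capv_idPl; exact: subvf.
Qed.

Lemma building_meet_map :
  poset_map (sub_set A (split_le le supplements) supplements)
    (sub_le le supplements) A le building_meet.
Proof.
have DUV0 W : (W + U + V0 = W + V0)%VS by rewrite -addvA (addv_idPr sUV0).
split.
  case=> [W [nW WV0]|[W B] /= [[nW WV0] [nB _] sW sB _]] /=.
    by case: ifPn => // sW; split=> //; rewrite DUV0.
  (* Adding [V0] absorbs [U], so the modular law reduces the sum to [W + V0]; the meet is proper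
     because it lies in [B]. *)
  split; last by rewrite -DUV0 meet_supplementDU // DUV0.
  by apply: contraNneq nB => e; rewrite eqEsubv subvf /= -{1}e capvSr.
case=> [W1|[W1 B1]] [W2|[W2 B2]] //= _ _; rewrite /subv_rel.
- move=> /andP[s12 /eqP <-]; case: ifPn => // _; exact: addvS.
- case: ifPn => // _ h; first exact: subv_trans (capvSr _ _) h.
  by apply: subv_trans (capvSl _ _) _; exact: addvS.
- by move=> /andP[sW sB]; apply: capvS => //; exact: addvS.
Qed.

(** On non-supplements the value depends only on the sum with [U], which the meet preserves;
    supplements are fixed. *)
Lemma building_map_meet z : sub_set A (split_le le supplements) supplements z ->
  building_map (building_meet z) = building_map (sub_fst z).
Proof.
case: z => [W _|[W B] /= [_ _ sW sB _]] /=.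
  case: (boolP (supplements W)) => // sW; rewrite /building_map (negbTE sW).
  rewrite [supplements _]/supplements -addvA addvv -/(supplements W) (negbTE sW).
  by rewrite quotient_imgDU.
rewrite /building_map {1}/supplements meet_supplementDU // -/(supplements W).
by rewrite (negbTE sW) -quotient_imgDU meet_supplementDU // quotient_imgDU.
Qed.

Lemma subv_building_meet z : sub_set A le supplements z ->
  le (sub_fst z) (building_meet z).
Proof.
case: z => [W _|[W B] /= [_ _ _ _ WB]] /=.
  by case: ifP => _; [exact: subvv|exact: addvSl].
by rewrite /subv_rel subv_cap addvSl.
Qed.

Lemma building_mapK y : A2 y -> building_map (building_section y) = y.
Proof.
case: y => [X [nX _]|W [_ WU]] /=; rewrite /building_map.
  by rewrite supplements_preim (negbTE nX) quotient_img_preim.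
by rewrite /supplements WU eqxx.
Qed.

Lemma split_le_section W :
  split_le le supplements W (building_section (building_map W)).
Proof.
rewrite /split_le /building_map; case: ifPn => _ /=; first by rewrite /subv_rel subvv.
by rewrite quotient_preim_img /subv_rel addvSl.
Qed.

Lemma building_map_hequiv (R : realType) :
  induces_hequiv R A le A2 le2 building_map.
Proof.
apply: (@split_induces_hequiv R _ _ A le A2 le2 supplements subv_order
  (@supplements_up) building_map building_section building_meet).
- exact: building_map_split.
- exact: building_section_split.
- exact: building_mapK.
- by move=> W _; exact: split_le_section.
- exact: building_meet_map.
- exact: building_map_meet.
- exact: subv_building_meet.
Qed.

Lemma building_map_poset_map : poset_map A le A2 le2 building_map.
Proof.
split; first exact: building_map_split.1.
by move=> W1 W2 A1 A2 s12; apply: building_map_split.2; rewrite /split_le ?s12.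
Qed.

End RelativeBuilding.

(** An isomorphism preserves sums and the full space, hence the case distinction; on non-supplements
    the commuting square concludes. *)
Lemma building_map_natural (K : fieldType) (V Q V' Q' : vectType K)
    (U : {vspace V}) (U' : {vspace V'}) (pi : 'Hom(V, Q)) (pi' : 'Hom(V', Q'))
    (g : 'Hom(V, V')) (h : 'Hom(Q, Q')) W :
  lin_iso g -> (g @: U)%VS = U' -> (forall v, h (pi v) = pi' (g v)) ->
  building_map U' pi' (g @: W)%VS =
  map_sum (fun X => (h @: X)%VS) (fun X => (g @: X)%VS) (building_map U pi W).
Proof.
move=> [/eqP kg ig] <- hpi; rewrite /building_map.
have -> : supplements (g @: U)%VS (g @: W)%VS = supplements U W.
  by rewrite /supplements -limgD -ig !eqEsubv !limg_ker0.
case: ifP => //= _; congr inl; rewrite -!limg_comp.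
by congr lfun_img; apply/lfunP => v; rewrite !lfunE /= hpi.
Qed.

Theorem theorem3p6 (R : realType) (K : fieldType) :
  exists Phi : forall (V Q : vectType K), {vspace V} -> {vspace V} ->
                 'Hom(V, Q) -> {vspace V} -> ({vspace Q} + {vspace V})%type,
    (forall (V Q : vectType K) (U V0 : {vspace V}) (pi : 'Hom(V, Q)),
       (U <= V0)%VS -> is_quotient U pi ->
       poset_map (rel_building V0) (@subv_rel K V)
         (join_set (rel_building (pi @: V0)%VS) (rel_building U))
         (join_le (@subv_rel K Q) (@subv_rel K V))
         (Phi V Q U V0 pi)
       /\ induces_hequiv R (rel_building V0) (@subv_rel K V)
         (join_set (rel_building (pi @: V0)%VS) (rel_building U))
         (join_le (@subv_rel K Q) (@subv_rel K V))
         (Phi V Q U V0 pi)) /\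
    (forall (V Q V' Q' : vectType K) (U V0 : {vspace V}) (U' V0' : {vspace V'})
            (pi : 'Hom(V, Q)) (pi' : 'Hom(V', Q'))
            (g : 'Hom(V, V')) (h : 'Hom(Q, Q')),
       (U <= V0)%VS -> is_quotient U pi ->
       (U' <= V0')%VS -> is_quotient U' pi' ->
       lin_iso g -> (g @: V0)%VS = V0' -> (g @: U)%VS = U' ->
       (forall v, h (pi v) = pi' (g v)) ->
       forall W, rel_building V0 W ->
         Phi V' Q' U' V0' pi' (g @: W)%VS =
         map_sum (fun X => (h @: X)%VS) (fun X => (g @: X)%VS) (Phi V Q U V0 pi W)).
Proof.
exists (fun V Q U _ pi => building_map U pi); split.
  move=> V Q U V0 pi sUV0 quo.
  by split; [exact: building_map_poset_map|exact: building_map_hequiv].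
move=> V Q V' Q' U V0 U' V0' pi pi' g h _ _ _ _ iso_g _ gU hpi W _.
exact: building_map_natural.
Qed.
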